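(* Let $A$ be a set of actions. For every star expression $e\in \mathit{StExp}(A)$ it holds that $\underline{\mathcal{C}}(e)_{(\cdot]}$ maps to $\mathcal{C}(e)$ by a functional bisimulation. That is, there is a partial function $f$ from the vertices of the induced chart $\underline{\mathcal{C}}(e)_{(\cdot]}$ of the $1$-chart interpretation $\underline{\mathcal{C}}(e)$ of $e$ to the vertices of the chart interpretation $\mathcal{C}(e)$ of $e$ whose graph is a bisimulation between $\underline{\mathcal{C}}(e)_{(\cdot]}$ and $\mathcal{C}(e)$.
   Context: **Star expressions.** For a set $A$ of actions, the set $\mathit{StExp}(A)$ of star expressions is given by the grammar $e ::= 0 \mid 1 \mid a \mid e_1+e_2 \mid e_1\cdot e_2 \mid e^{*}$ (with $a\in A$). **LTSs.** An LTS (with termination) is a tuple $\langle S,A,\to,\downarrow\rangle$ with $S$ a nonempty set of states, $\to\,\subseteq S\times A\times S$ (written $s\xrightarrow{a}s'$), and $\downarrow\,\subseteq S$ the set of immediately terminating states (written $s{\downarrow}$). A chart is an LTS together with a start vertex $v_{\mathrm s}$, where the set $V$ of states (vertices) is finite. **Process semantics $\mathcal{T}(A)$.** Termination and transitions of star expressions are those derivable by the rules: $1{\downarrow}$; $e_i{\downarrow}\Rightarrow(e_1+e_2){\downarrow}$ ($i\in\{1,2\}$); $e_1{\downarrow},e_2{\downarrow}\Rightarrow(e_1\cdot e_2){\downarrow}$; $(e^* ){\downarrow}$; $a\xrightarrow{a}1$; $e_i\xrightarrow{a}e_i'\Rightarrow e_1+e_2\xrightarrow{a}e_i'$ ($i\in\{1,2\}$);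 $e_1\xrightarrow{a}e_1'\Rightarrow e_1\cdot e_2\xrightarrow{a}e_1'\cdot e_2$; $e_1{\downarrow},\,e_2\xrightarrow{a}e_2'\Rightarrow e_1\cdot e_2\xrightarrow{a}e_2'$; $e\xrightarrow{a}e'\Rightarrow e^*\xrightarrow{a}e'\cdot e^*$. This defines the LTS $\mathcal{L}(\mathit{StExp}(A))$ on $\mathit{StExp}(A)$. The chart interpretation $\mathcal{C}(e)$ of $e$ is the sub-LTS of $\mathcal{L}(\mathit{StExp}(A))$ consisting of everything reachable from $e$, with start vertex $e$ (it is known to be finite). **Stacked star expressions.** The set $\mathit{StExp}^{( * )}(A)$ is given by the grammar $E ::= e \mid E\cdot e \mid E\ast e^{*}$ with $e\in\mathit{StExp}(A)$, where $\ast$ is a new binary symbol (stacked product), and $E\cdot e$ for a star expression $E$ is the ordinary star expression product. **Variant semantics $\underline{\mathcal{T}}^{( * )}(A)$.** Let $\underline{A}=A\cup\{1\}$, where the label $1\notin A$ is the empty-step label; $a$ ranges over $A$ and $\underline a$ over $\underline A$; lower-case $e$'s are star expressions, capital $E$'s are stacked star expressions. The rules are: $1{\downarrow}$; $e_i{\downarrow}\Rightarrow(e_1+e_2){\downarrow}$; $e_1{\downarrow},e_2{\downarrow}\Rightarrow(e_1\cdot e_2){\downarrow}$; $(e^* ){\downarrow}$; $a\xrightarrow{a}1$; $e_i\xrightarrow{a}E_i'\Rightarrow e_1+e_2\xrightarrow{a}E_i'$; $E_1\xrightarrow{\underline a}E_1'\Rightarrow E_1\cdot e_2\xrightarrow{\underline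 a}E_1'\cdot e_2$; $e_1{\downarrow},\,e_2\xrightarrow{a}E_2'\Rightarrow e_1\cdot e_2\xrightarrow{a}E_2'$; $e\xrightarrow{a}E'\Rightarrow e^*\xrightarrow{a}E'\ast e^*$; $E_1\xrightarrow{\underline a}E_1'\Rightarrow E_1\ast e_2^*\xrightarrow{\underline a}E_1'\ast e_2^*$; $e_1{\downarrow}\Rightarrow e_1\ast e_2^*\xrightarrow{1}e_2^*$. This defines a $1$-LTS (an LTS with labels in $\underline A$) $\underline{\mathcal{L}}(\mathit{StExp}^{( * )}(A))$ on $\mathit{StExp}^{( * )}(A)$. The $1$-chart interpretation $\underline{\mathcal{C}}(e)$ of a star expression $e$ is its part reachable from $e$ (by all transitions, including $1$-transitions), with start vertex $e$. **Induced chart.** The induced chart $\underline{\mathcal{C}}_{(\cdot]}$ of a $1$-chart $\underline{\mathcal{C}}$ has the same vertices and start vertex, and labels in $A$. It has a transition $s\xrightarrow{(a]}s'$ (regarded as an $a$-transition) for $a\in A$ iff $s=s_0\xrightarrow{1}s_1\xrightarrow{1}\cdots\xrightarrow{1}s_n\xrightarrow{a}s'$ in $\underline{\mathcal{C}}$ for some $n\ge 0$. A vertex $s$ terminates (written $s{\downarrow^{(1)}}$) iff $s=s_0\xrightarrow{1}\cdots\xrightarrow{1}s_n$ with $s_n{\downarrow}$ in $\underline{\mathcal{C}}$ for some $n\ge0$. **Bisimulation.** A bisimulation between LTSs $\mathcal L_1,\mathcal L_2$ (with state sets $S_1,S_2$) is a nonempty relation $B\subseteq S_1\times S_2$ such that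 for all $\langle s_1,s_2\rangle\in B$: (forth) if $s_1\xrightarrow{a}s_1'$ then there is $s_2'$ with $s_2\xrightarrow{a}s_2'$ and $\langle s_1',s_2'\rangle\in B$; (back) if $s_2\xrightarrow{a}s_2'$ then there is $s_1'$ with $s_1\xrightarrow{a}s_1'$ and $\langle s_1',s_2'\rangle\in B$; (termination) $s_1{\downarrow}\Leftrightarrow s_2{\downarrow}$. A bisimulation between charts must additionally relate the two start vertices. *)

(* Defs.v *)
From Stdlib Require Import List Relations Classical ProofIrrelevance FinFun.
Import ListNotations.
Set Implicit Arguments.

(** * Labelled transition systems and charts *)

Record lts (L : Type) := Lts {
  state :> Type;
  lts_nonempty : inhabited state;
  step : state -> L -> state -> Prop;
  terminates : state -> Prop
}.
Arguments Lts {L} state lts_nonempty step terminates.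
Arguments step {L} l _ _ _.
Arguments terminates {L} l _.

Record chart (L : Type) := Chart {
  chart_lts :> lts L;
  start : chart_lts;
  chart_finite : Finite chart_lts
}.
Arguments Chart {L} chart_lts start chart_finite.
Arguments start {L} c.

(** The empty-step label [1] is [None]; a proper action [a] is [Some a]. *)
Definition one_lts (A : Type) := lts (option A).
Definition one_chart (A : Type) := chart (option A).

(** ** The part of an LTS that is reachable from a state *)

Definition reachable (L : Type) (M : lts L) : M -> M -> Prop :=
  clos_refl_trans M (fun s t => exists l, step M s l t).

Definition reachable_part (L : Type) (M : lts L) (s : M) : lts L :=
  Lts {t : M | reachable M s t}
      (inhabits (exist _ s (rt_refl _ _ s)))
      (fun t l t' => step M (proj1_sig t) l (proj1_sig t'))
      (fun t => terminates M (proj1_sig t)).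

Definition reachable_start (L : Type) (M : lts L) (s : M) :
  reachable_part M s := exist _ s (rt_refl _ _ s).

Lemma reachable_part_finite (L : Type) (M : lts L) (s : M) (ts : list M) :
  (forall t, reachable M s t -> In t ts) -> Finite (reachable_part M s).
Proof.
  intros Hts.
  assert (H : forall us : list M, exists vs : list (reachable_part M s),
             forall v : reachable_part M s, In (proj1_sig v) us -> In v vs).
  { induction us as [|u us [vs IH]].
    - exists []. intros v [].
    - destruct (classic (reachable M s u)) as [Hu|Hu].
      + exists (exist _ u Hu :: vs). intros [v Hv] [E|Hin].
        * left. simpl in E. subst v. f_equal. apply proof_irrelevance.
        * right. now apply IH.
      + exists vs. intros [v Hv] [E|Hin].
        * simpl in E. now subst v.
        * now apply IH. }
  destruct (H ts) as [vs Hvs]. exists vs. intros v.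
  apply Hvs, Hts, (proj2_sig v).
Qed.

Lemma reachable_closed (L : Type) (M : lts L) (s : M) (P : M -> Prop) :
  P s -> (forall t l t', P t -> step M t l t' -> P t') ->
  forall t, reachable M s t -> P t.
Proof.
  intros Hs Hc t Ht. apply clos_rt_rtn1 in Ht.
  induction Ht as [|t t' [l Hl] _ IH]; eauto.
Qed.

(** ** Bisimulations *)

Definition bisimulation (L : Type) (M1 M2 : lts L) (B : M1 -> M2 -> Prop) :
    Prop :=
  (exists s1 s2, B s1 s2) /\
  forall s1 s2, B s1 s2 ->
    (forall a s1', step M1 s1 a s1' ->
       exists s2', step M2 s2 a s2' /\ B s1' s2') /\
    (forall a s2', step M2 s2 a s2' ->
       exists s1', step M1 s1 a s1' /\ B s1' s2') /\
    (terminates M1 s1 <-> terminates M2 s2).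

Definition chart_bisimulation (L : Type) (C1 C2 : chart L)
    (B : C1 -> C2 -> Prop) : Prop :=
  bisimulation C1 C2 B /\ B (start C1) (start C2).

(** A partial function is undefined where its value is [None]. *)
Definition graph (X Y : Type) (f : X -> option Y) : X -> Y -> Prop :=
  fun x y => f x = Some y.

(** ** Induced LTSs and induced charts *)

Definition one_steps (A : Type) (M : one_lts A) : M -> M -> Prop :=
  clos_refl_trans_1n M (fun s t => step M s None t).

Definition induced_lts (A : Type) (M : one_lts A) : lts A :=
  Lts M (lts_nonempty M)
      (fun s a s' => exists t, one_steps M s t /\ step M t (Some a) s')
      (fun s => exists t, one_steps M s t /\ terminates M t).

Definition induced_chart (A : Type) (C : one_chart A) : chart A :=
  Chart (induced_lts C) (start C) (chart_finite C).

(** * Star expressions and their process semantics *)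

Inductive stexp (A : Type) : Type :=
| Zero : stexp A
| One : stexp A
| Act : A -> stexp A
| Plus : stexp A -> stexp A -> stexp A
| Times : stexp A -> stexp A -> stexp A
| Star : stexp A -> stexp A.
Arguments Zero {A}.
Arguments One {A}.

Inductive st_term (A : Type) : stexp A -> Prop :=
| term_one : st_term One
| term_plus_l e1 e2 : st_term e1 -> st_term (Plus e1 e2)
| term_plus_r e1 e2 : st_term e2 -> st_term (Plus e1 e2)
| term_times e1 e2 : st_term e1 -> st_term e2 -> st_term (Times e1 e2)
| term_star e : st_term (Star e).

Inductive st_step (A : Type) : stexp A -> A -> stexp A -> Prop :=
| step_act a : st_step (Act a) a One
| step_plus_l e1 e2 a e' : st_step e1 a e' -> st_step (Plus e1 e2) a e'
| step_plus_r e1 e2 a e' : st_step e2 a e' -> st_step (Plus e1 e2) a e'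
| step_times_l e1 e2 a e1' :
    st_step e1 a e1' -> st_step (Times e1 e2) a (Times e1' e2)
| step_times_r e1 e2 a e2' :
    st_term e1 -> st_step e2 a e2' -> st_step (Times e1 e2) a e2'
| step_star e a e' : st_step e a e' -> st_step (Star e) a (Times e' (Star e)).

Definition stexp_lts (A : Type) : lts A :=
  Lts (stexp A) (inhabits Zero) (@st_step A) (@st_term A).

Lemma st_step_finite (A : Type) (e : stexp A) : exists ds : list (stexp A),
  (forall a e', st_step e a e' -> In e' ds) /\
  (forall d a d', In d ds -> st_step d a d' -> In d' ds).
Proof.
  induction e as [| |a|e1 [l1 [I1 C1]] e2 [l2 [I2 C2]]
                 |e1 [l1 [I1 C1]] e2 [l2 [I2 C2]]|e [l [I C]]].
  - exists []. split; [intros a e' H; inversion H|intros d a d' []].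
  - exists []. split; [intros a e' H; inversion H|intros d a d' []].
  - exists [One]. split.
    + intros b e' H. inversion H; subst. now left.
    + intros d b d' [<-|[]] H. inversion H.
  - exists (l1 ++ l2). split.
    + intros a e' H. apply in_or_app. inversion H; subst; eauto.
    + intros d a d' Hd H. apply in_or_app.
      apply in_app_or in Hd as [Hd|Hd]; eauto.
  - exists (map (fun d => Times d e2) l1 ++ l2). split.
    + intros a e' H. apply in_or_app. inversion H; subst; eauto.
      left. apply (in_map (fun d => Times d e2)). eauto.
    + intros d a d' Hd H. apply in_or_app.
      apply in_app_or in Hd as [Hd|Hd]; eauto.
      apply in_map_iff in Hd as [x [<- Hx]]. inversion H; subst; eauto.
      left. apply (in_map (fun d => Times d e2)). eauto.
  - exists (map (fun d => Times d (Star e)) l). split.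
    + intros a e' H. inversion H; subst.
      apply (in_map (fun d => Times d (Star e))). eauto.
    + intros d a d' Hd H. apply in_map_iff in Hd as [x [<- Hx]].
      inversion H as [| | |? ? ? ? H'|? ? ? ? _ H'|]; subst.
      * apply (in_map (fun d => Times d (Star e))). eauto.
      * inversion H'; subst.
        apply (in_map (fun d => Times d (Star e))). eauto.
Qed.

Lemma chart_interp_finite (A : Type) (e : stexp A) :
  Finite (reachable_part (stexp_lts A) e).
Proof.
  destruct (st_step_finite e) as [ds [I C]].
  apply reachable_part_finite with (ts := e :: ds).
  apply reachable_closed.
  - now left.
  - intros t l t' [<-|Ht] H; right; [eapply I|eapply C]; eauto.
Qed.

Definition chart_interp (A : Type) (e : stexp A) : chart A :=
  Chart (reachable_part (stexp_lts A) e) (reachable_start (stexp_lts A) e)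
        (chart_interp_finite e).

(** * Stacked star expressions and the variant process semantics *)

(** The grammar [E ::= e | E . e | E * e^*] is ambiguous on products of star
    expressions, since [e1 . e2] is then the star expression product.  This is
    its unambiguous form [E ::= e | P], [P ::= E * e^* | P . e]: [Proper P] are
    the stacked star expressions that contain a stacked product.
    [Stack E e] stands for [E * e^*]. *)
Inductive sstexp (A : Type) : Type :=
| Base : stexp A -> sstexp A
| Proper : pstexp A -> sstexp A
with pstexp (A : Type) : Type :=
| Stack : sstexp A -> stexp A -> pstexp A
| PTimes : pstexp A -> stexp A -> pstexp A.

(** The product [E . e] of the ambiguous grammar. *)
Definition STimes (A : Type) (E : sstexp A) (e : stexp A) : sstexp A :=
  match E with
  | Base e1 => Base (Times e1 e)
  | Proper P => Proper (PTimes P e)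
  end.

Definition SStack (A : Type) (E : sstexp A) (e : stexp A) : sstexp A :=
  Proper (Stack E e).

(** The termination rules of the variant semantics are those of [st_term], and
    have star expressions only as subjects. *)
Inductive sst_term (A : Type) : sstexp A -> Prop :=
| sterm_base e : st_term e -> sst_term (Base e).

Inductive sst_step (A : Type) : sstexp A -> option A -> sstexp A -> Prop :=
| sstep_act a : sst_step (Base (Act a)) (Some a) (Base One)
| sstep_plus_l e1 e2 a E' :
    sst_step (Base e1) (Some a) E' -> sst_step (Base (Plus e1 e2)) (Some a) E'
| sstep_plus_r e1 e2 a E' :
    sst_step (Base e2) (Some a) E' -> sst_step (Base (Plus e1 e2)) (Some a) E'
| sstep_times_l E1 e2 l E1' :
    sst_step E1 l E1' -> sst_step (STimes E1 e2) l (STimes E1' e2)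
| sstep_times_r e1 e2 a E2' :
    st_term e1 -> sst_step (Base e2) (Some a) E2' ->
    sst_step (Base (Times e1 e2)) (Some a) E2'
| sstep_star e a E' :
    sst_step (Base e) (Some a) E' ->
    sst_step (Base (Star e)) (Some a) (SStack E' e)
| sstep_stack E1 e2 l E1' :
    sst_step E1 l E1' -> sst_step (SStack E1 e2) l (SStack E1' e2)
| sstep_stack_one e1 e2 :
    st_term e1 -> sst_step (SStack (Base e1) e2) None (Base (Star e2)).

Definition sstexp_lts (A : Type) : one_lts A :=
  Lts (sstexp A) (inhabits (Base Zero)) (@sst_step A) (@sst_term A).

Lemma STimes_inj (A : Type) (E1 E2 : sstexp A) (e1 e2 : stexp A) :
  STimes E1 e1 = STimes E2 e2 -> E1 = E2 /\ e1 = e2.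
Proof.
  destruct E1, E2; simpl; intros H; inversion H; subst; auto.
Qed.

Lemma sst_step_STimes_inv (A : Type) (E : sstexp A) (e : stexp A) l E' :
  sst_step (STimes E e) l E' ->
  (exists E1, sst_step E l E1 /\ E' = STimes E1 e) \/
  (exists e1, E = Base e1 /\ st_term e1 /\ sst_step (Base e) l E').
Proof.
  intros H. inversion H as [? HE|? ? ? ? ? HE|? ? ? ? ? HE|? ? ? ? HE1 HE
    |? ? ? ? HT HS HE|? ? ? ? HE|? ? ? ? ? HE|? ? ? HE]; subst.
  - destruct E; discriminate HE.
  - destruct E; discriminate HE.
  - destruct E; discriminate HE.
  - apply STimes_inj in HE as [-> ->]. left. eauto.
  - right. destruct E; simpl in HE; inversion HE; subst. eauto.
  - destruct E; discriminate HE.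
  - destruct E; discriminate HE.
  - destruct E; discriminate HE.
Qed.

Lemma sst_step_SStack_inv (A : Type) (E : sstexp A) (e : stexp A) l E' :
  sst_step (SStack E e) l E' ->
  (exists E1, sst_step E l E1 /\ E' = SStack E1 e) \/
  (exists e1, E = Base e1 /\ st_term e1 /\ l = None /\ E' = Base (Star e)).
Proof.
  unfold SStack at 1. intros H.
  inversion H as [| | |E1 ? ? ? ? HE| | | |]; subst; eauto 6.
  destruct E1; discriminate HE.
Qed.

Lemma sst_step_base_inv (A : Type) (e : stexp A) l E' :
  sst_step (Base e) l E' ->
  match e with
  | Zero | One => False
  | Act a => l = Some a /\ E' = Base One
  | Plus e1 e2 => sst_step (Base e1) l E' \/ sst_step (Base e2) l E'
  | Times e1 e2 => sst_step (STimes (Base e1) e2) l E'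
  | Star e1 => exists E1, sst_step (Base e1) l E1 /\ E' = SStack E1 e1
  end.
Proof.
  intros H. destruct e; try exact H;
  inversion H as [| | |E1 ? ? ? ? HE| | | |]; subst; eauto;
  destruct E1; discriminate HE.
Qed.

Lemma sst_step_finite (A : Type) (e : stexp A) : exists ds : list (sstexp A),
  (forall l E', sst_step (Base e) l E' -> In E' ds) /\
  (forall D l D', In D ds -> sst_step D l D' -> In D' ds).
Proof.
  induction e as [| |a|e1 [l1 [I1 C1]] e2 [l2 [I2 C2]]
                 |e1 [l1 [I1 C1]] e2 [l2 [I2 C2]]|e [ds [I C]]].
  - exists []. split; [intros l E' H; now apply sst_step_base_inv in H
                      |intros D l D' []].
  - exists []. split; [intros l E' H; now apply sst_step_base_inv in H
                      |intros D l D' []].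
  - exists [Base One]. split.
    + intros l E' H. apply sst_step_base_inv in H as [_ ->]. now left.
    + intros D l D' [<-|[]] H. now apply sst_step_base_inv in H.
  - exists (l1 ++ l2). split.
    + intros l E' H. apply in_or_app.
      apply sst_step_base_inv in H as [H|H]; eauto.
    + intros D l D' HD H. apply in_or_app.
      apply in_app_or in HD as [HD|HD]; eauto.
  - assert (K : forall E l E', (forall E1, sst_step E l E1 -> In E1 l1) ->
               sst_step (STimes E e2) l E' ->
               In E' (map (fun D => STimes D e2) l1 ++ l2)).
    { intros E l E' HE H. apply in_or_app.
      apply sst_step_STimes_inv in H as [[E1 [H ->]]|[e1' [_ [_ H]]]].
      - left. apply (in_map (fun D => STimes D e2)). auto.
      - right. eauto. }
    exists (map (fun D => STimes D e2) l1 ++ l2). split.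
    + intros l E' H. apply sst_step_base_inv in H. eauto.
    + intros D l D' HD H. apply in_app_or in HD as [HD|HD].
      * apply in_map_iff in HD as [X [<- HX]]. eauto.
      * apply in_or_app. eauto.
  - exists (Base (Star e) :: map (fun D => SStack D e) ds).
    assert (K : forall l E', sst_step (Base (Star e)) l E' ->
               In E' (Base (Star e) :: map (fun D => SStack D e) ds)).
    { intros l E' H. apply sst_step_base_inv in H as [E1 [H ->]].
      right. apply (in_map (fun D => SStack D e)). eauto. }
    split; [exact K|].
    intros D l D' [<-|HD] H; [eauto|].
    apply in_map_iff in HD as [X [<- HX]].
    apply sst_step_SStack_inv in H as [[E1 [H ->]]|[e1 [_ [_ [_ ->]]]]].
    + right. apply (in_map (fun D => SStack D e)). eauto.
    + now left.
Qed.

Lemma one_chart_interp_finite (A : Type) (e : stexp A) :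
  Finite (reachable_part (sstexp_lts A) (Base e)).
Proof.
  destruct (sst_step_finite e) as [ds [I C]].
  apply reachable_part_finite with (ts := Base e :: ds).
  apply reachable_closed.
  - now left.
  - intros t l t' [<-|Ht] H; right; [eapply I|eapply C]; eauto.
Qed.

Definition one_chart_interp (A : Type) (e : stexp A) : one_chart A :=
  Chart (reachable_part (sstexp_lts A) (Base e))
        (reachable_start (sstexp_lts A) (Base e))
        (one_chart_interp_finite e).

(* Main.v *)
(** The witness is the projection that replaces every stacked product by an
    ordinary one. An empty step of [E] leads to an expression whose projection
    has no more behavior than that of [E], and [proj E] terminates only if empty
    steps lead from [E] to a terminating star expression, so projection is
    compatible with induced transitions and induced termination. The function
    has to be partial because an empty step may lead to a star expression [e^*]
    that is not itself a vertex of the chart interpretation, as for [b . a^*]. *)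

From Stdlib Require Import Relations ClassicalEpsilon ProofIrrelevance.
Require Import Defs.

Set Implicit Arguments.

Fixpoint proj (A : Type) (E : sstexp A) : stexp A :=
  match E with
  | Base e => e
  | Proper P => pproj P
  end
with pproj (A : Type) (P : pstexp A) : stexp A :=
  match P with
  | Stack E e => Times (proj E) (Star e)
  | PTimes P e => Times (pproj P) e
  end.

Lemma proj_STimes (A : Type) (E : sstexp A) (e : stexp A) :
  proj (STimes E e) = Times (proj E) e.
Proof. now destruct E. Qed.

Scheme sstexp_mut := Induction for sstexp Sort Prop
  with pstexp_mut := Induction for pstexp Sort Prop.

(** The induction principle of the ambiguous grammar. *)
Lemma sstexp_stacked_ind (A : Type) (Q : sstexp A -> Prop) :
  (forall e, Q (Base e)) ->
  (forall E e, Q E -> Q (STimes E e)) ->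
  (forall E e, Q E -> Q (SStack E e)) ->
  forall E, Q E.
Proof.
  intros HB HT HS.
  apply (@sstexp_mut A Q (fun P => Q (Proper P))); auto.
  - intros E IH e. exact (HS E e IH).
  - intros P IH e. exact (HT (Proper P) e IH).
Qed.

(** Read through [proj], each rule for a proper action is a rule of the process semantics; a step
    below a stack becomes the left product rule. *)
Lemma proj_step (A : Type) (E E' : sstexp A) (l : option A) :
  sst_step E l E' ->
  forall a, l = Some a -> st_step (proj E) a (proj E').
Proof.
  induction 1; intros b Hb; try discriminate Hb;
    rewrite ?proj_STimes; simpl in *;
    try (injection Hb as <-); subst; auto using st_step.
Qed.

(** Dropping a terminated [e1] loses the steps of [e1], so in general only inclusions hold:
    [Times e1 (Star e2)] has the termination and the steps of [Star e2] by the product rules.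
    Contexts to the right preserve both inclusions. *)
Lemma proj_one_step (A : Type) (E E' : sstexp A) (l : option A) :
  sst_step E l E' -> l = None ->
  (st_term (proj E') -> st_term (proj E)) /\
  (forall a d, st_step (proj E') a d -> st_step (proj E) a d).
Proof.
  induction 1 as [| | |E e l E' _ IH| | |E e l E' _ IH|e1 e2 He1];
    intros Hl; try discriminate Hl; rewrite ?proj_STimes; simpl.
  (* These two goals are the context rules for products and for stacks. *)
  1, 2: destruct (IH Hl) as [IHt IHs]; split;
    [intros H; inversion H; subst; auto using st_term
    |intros a d H; inversion H; subst; auto using st_step].
  split; auto using st_term, st_step.
Qed.

Lemma proj_one_steps (A : Type) (E E' : sstexp A) :
  one_steps (sstexp_lts A) E E' ->
  (st_term (proj E') -> st_term (proj E)) /\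
  (forall a d, st_step (proj E') a d -> st_step (proj E) a d).
Proof.
  induction 1 as [|E F G HEF _ [IHt IHs]]; [auto|].
  destruct (proj_one_step HEF eq_refl). auto.
Qed.

Lemma one_steps_map (A : Type) (M N : one_lts A) (h : M -> N) :
  (forall s t, step M s None t -> step N (h s) None (h t)) ->
  forall s t, one_steps M s t -> one_steps N (h s) (h t).
Proof.
  intros Hh s t. induction 1; [apply rt1n_refl|].
  eapply Relation_Operators.rt1n_trans; [apply Hh|]; eassumption.
Qed.

Lemma one_steps_STimes (A : Type) (E E' : sstexp A) (e : stexp A) :
  one_steps (sstexp_lts A) E E' ->
  one_steps (sstexp_lts A) (STimes E e) (STimes E' e).
Proof.
  apply (@one_steps_map A (sstexp_lts A) (sstexp_lts A) (fun E => STimes E e)).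
  intros s t. apply sstep_times_l.
Qed.

Lemma one_steps_SStack (A : Type) (E E' : sstexp A) (e : stexp A) :
  one_steps (sstexp_lts A) E E' ->
  one_steps (sstexp_lts A) (SStack E e) (SStack E' e).
Proof.
  apply (@one_steps_map A (sstexp_lts A) (sstexp_lts A) (fun E => SStack E e)).
  intros s t. apply sstep_stack.
Qed.

Lemma one_steps_SStack_term (A : Type) (E : sstexp A) (e1 e : stexp A) :
  one_steps (sstexp_lts A) E (Base e1) -> st_term e1 ->
  one_steps (sstexp_lts A) (SStack E e) (Base (Star e)).
Proof.
  intros H He1. apply clos_rt_rt1n.
  apply rt_trans with (SStack (Base e1) e).
  - apply clos_rt1n_rt. now apply one_steps_SStack.
  - apply rt_step. now apply sstep_stack_one.
Qed.

(** Only star expressions terminate, so stacks must be unwound by empty steps. A terminating product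
    has terminating factors, and the path that empties the left one lifts to the context. *)
Lemma proj_term_inv (A : Type) (E : sstexp A) :
  st_term (proj E) ->
  exists e, one_steps (sstexp_lts A) E (Base e) /\ st_term e.
Proof.
  induction E as [e|E e IH|E e IH] using sstexp_stacked_ind;
    rewrite ?proj_STimes; simpl; intros H.
  - exists e. split; [apply rt1n_refl|exact H].
  - inversion H; subst. destruct IH as [e1 [H1 He1]]; auto.
    (* [STimes (Base e1) e] computes to this product. *)
    exists (Times e1 e). split; auto using st_term.
    exact (one_steps_STimes e H1).
  - inversion H; subst. destruct IH as [e1 [H1 He1]]; auto.
    (* One more empty step discards the emptied left factor. *)
    exists (Star e). split; auto using st_term.
    exact (one_steps_SStack_term e H1 He1).
Qed.

(** On star expressions the rules of both semantics correspond, and the stack that the star rule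
    creates projects back to the ordinary product. *)
Lemma base_step_inv (A : Type) (e : stexp A) (a : A) (d : stexp A) :
  st_step e a d -> exists E, sst_step (Base e) (Some a) E /\ proj E = d.
Proof.
  induction 1 as [a|e1 e2 a d _ [E [H <-]]|e1 e2 a d _ [E [H <-]]
    |e1 e2 a d _ [E [H <-]]|e1 e2 a d He1 _ [E [H <-]]|e a d _ [E [H <-]]].
  - exists (Base One). auto using sst_step.
  - exists E. auto using sst_step.
  - exists E. auto using sst_step.
  - exists (STimes E e2). split; [exact (sstep_times_l e2 H)|apply proj_STimes].
  - exists E. auto using sst_step.
  - exists (SStack E e). auto using sst_step.
Qed.

(** A step of the left factor is lifted to the context. Before a step of the right factor, the left
    factor, which then terminates, is emptied by [proj_term_inv]. *)
Lemma proj_step_inv (A : Type) (E : sstexp A) (a : A) (d : stexp A) :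
  st_step (proj E) a d ->
  exists F E', one_steps (sstexp_lts A) E F /\
    sst_step F (Some a) E' /\ proj E' = d.
Proof.
  revert a d. induction E as [e|E e IH|E e IH] using sstexp_stacked_ind;
    intros a d; rewrite ?proj_STimes; simpl; intros H.
  - destruct (base_step_inv H) as [E' [HE' Hd]].
    exists (Base e), E'. split; [apply rt1n_refl|auto].
  - inversion H as [| | |? ? ? d' H'|? ? ? ? Ht H'|]; subst.
    + destruct (IH _ _ H') as [F [E' [HF [HE' <-]]]].
      exists (STimes F e), (STimes E' e).
      rewrite proj_STimes. auto using sst_step, one_steps_STimes.
    + destruct (proj_term_inv E Ht) as [e1 [H1 He1]].
      destruct (base_step_inv H') as [E' [HE' Hd]].
      exists (Base (Times e1 e)), E'.
      split; [exact (one_steps_STimes e H1)|auto using sst_step].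
  - inversion H as [| | |? ? ? d' H'|? ? ? ? Ht H'|]; subst.
    + destruct (IH _ _ H') as [F [E' [HF [HE' <-]]]].
      exists (SStack F e), (SStack E' e).
      auto using sst_step, one_steps_SStack.
    + destruct (proj_term_inv E Ht) as [e1 [H1 He1]].
      destruct (base_step_inv H') as [E' [HE' Hd]].
      (* Stacks have no right product rule: the step is taken after the stack is dropped. *)
      exists (Base (Star e)), E'. eauto using one_steps_SStack_term.
Qed.

Lemma reachable_step (L : Type) (M : lts L) (s t t' : M) (l : L) :
  reachable M s t -> step M t l t' -> reachable M s t'.
Proof.
  intros Ht Hl. eapply rt_trans; [exact Ht|]. apply rt_step. now exists l.
Qed.

Arguments reachable_step {L} M {s t t' l} _ _.

(** Reachability passes along the path, which therefore stays inside the reachable part. *)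
Lemma one_steps_reachable_part (A : Type) (M : one_lts A) (s t u : M)
    (Ht : reachable M s t) :
  one_steps M t u ->
  exists Hu : reachable M s u,
    one_steps (reachable_part M s) (exist _ t Ht) (exist _ u Hu).
Proof.
  intros H. revert Ht. induction H as [t|t v u Htv _ IH]; intros Ht.
  - exists Ht. apply rt1n_refl.
  - destruct (IH (reachable_step M Ht Htv)) as [Hu H].
    exists Hu. eapply Relation_Operators.rt1n_trans; [|exact H]. exact Htv.
Qed.

Lemma one_steps_proj1_sig (A : Type) (M : one_lts A) (s : M)
    (t u : reachable_part M s) :
  one_steps (reachable_part M s) t u ->
  one_steps M (proj1_sig t) (proj1_sig u).
Proof.
  apply (@one_steps_map A (reachable_part M s) M (@proj1_sig _ _)). auto.
Qed.

(** Reachability is decided classically; this is where partiality enters. *)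
Definition to_reachable (L : Type) (M : lts L) (s t : M) :
    option (reachable_part M s) :=
  match excluded_middle_informative (reachable M s t) with
  | left H => Some (exist _ t H)
  | right _ => None
  end.

Lemma to_reachable_iff (L : Type) (M : lts L) (s t : M)
    (u : reachable_part M s) :
  to_reachable M s t = Some u <-> t = proj1_sig u.
Proof.
  unfold to_reachable. destruct u as [u Hu]. simpl.
  destruct (excluded_middle_informative (reachable M s t)) as [Ht|Ht].
  - split.
    + now intros [= ->].
    + intros ->. do 2 f_equal. apply proof_irrelevance.
  - split; [discriminate|]. now intros ->.
Qed.

Theorem theorem5p9 (A : Type) (e : stexp A) :
  exists f : induced_chart (one_chart_interp e) -> option (chart_interp e),
    chart_bisimulation (induced_chart (one_chart_interp e)) (chart_interp e)
                       (graph f).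
Proof.
  exists (fun E => to_reachable (stexp_lts A) e (proj (proj1_sig E))).
  assert (Hs : to_reachable (stexp_lts A) e e
               = Some (reachable_start (stexp_lts A) e))
    by now apply to_reachable_iff.
  split; [split|exact Hs].
  - exists (start (one_chart_interp e)), (start (chart_interp e)). exact Hs.
  - intros [E HE] [d Hd] H. unfold graph in H.
    apply to_reachable_iff in H. simpl in H. subst d. repeat split.
    + intros a [E' HE'] [[F HF] [H1 H2]].
      apply one_steps_proj1_sig in H1. simpl in H1, H2.
      assert (H3 : st_step (proj E) a (proj E')).
      (* The empty steps from [E] to [F] add no behavior, so the step of [proj F] is one of
         [proj E]. *)
      { apply (proj_one_steps H1). exact (proj_step H2 eq_refl). }
      (* [proj E'] inherits reachability from [proj E], so the function is defined at [E']. *)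
      exists (exist _ (proj E') (reachable_step (stexp_lts A) Hd H3)).
      split; [exact H3|]. now apply to_reachable_iff.
    + intros a [d' Hd'] H. simpl in H.
      destruct (proj_step_inv E H) as [F [E' [H1 [H2 <-]]]].
      destruct (one_steps_reachable_part HE H1) as [HF H3].
      exists (exist _ E' (reachable_step (sstexp_lts A) HF H2)). split.
      * exists (exist _ F HF). split; [exact H3|exact H2].
      * now apply to_reachable_iff.
    + intros [[F HF] [H1 H2]]. apply one_steps_proj1_sig in H1.
      simpl in H1, H2. apply (proj_one_steps H1). now destruct H2.
    + intros H. simpl in H. destruct (proj_term_inv E H) as [e1 [H1 He1]].
      destruct (one_steps_reachable_part HE H1) as [HF H3].
      exists (exist _ (Base e1) HF). split; [exact H3|].
      now constructor.
Qed.
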